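(* Let $\triangle P_1P_2P_3$ be a (closed, filled) triangle in $D$. If for all $i,j,k$ with $\{i,j,k\}=\{1,2,3\}$ one has $\Delta_2'(P_i,P_j)>\delta(P_i,P_j,P_k)$, then $\rho(\psi_{\triangle P_1P_2P_3})>\frac{2}{5}$.
   Context: $D$ is the open unit disk in $\mathbb R^2$, $S^1$ its boundary circle identified with $\mathbb R/\mathbb Z$ via the counterclockwise normalized angle. For a closed convex $U\subset D$ and $v\in S^1$, $\psi_U(v)$ is the point $w\in S^1\setminus\{v\}$ such that the line $vw$ meets $U$ and $U$ lies in the closed half-plane to the left of the directed line from $v$ to $w$; it is an orientation-preserving homeomorphism of $S^1$. For such $f$, $\rho(f)=\lim_{n\to\infty}(\overline f^n(x)-x)/n$ with $\overline f$ the lift to $\mathbb R$ satisfying $\overline f(0)\in[0,1)$. Regard $D$ as the Beltrami–Klein model (hyperbolic lines are chords). For distinct $P,Q\in D$ with chord endpoints $v_1,v_2\in S^1$, $d'(P,Q)=\tfrac12\left|\log\frac{|v_1Q||v_2P|}{|v_1P||v_2Q|}\right|$; $\Delta_n'(P,Q)=\log\frac{e^{n d'(P,Q)}+1}{e^{n d'(P,Q)}-1}$ for $n\in\mathbb Z_{>0}$; $\delta(P,Q,R)=\min\{d'(R,S): S \text{ on the chord through } P,Q\}$. *)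

(* Defs.v *)
From Stdlib Require Import Reals.
From Coquelicot Require Import Coquelicot.
Open Scope R_scope.

Definition pt := (R * R)%type.

Definition padd (p q : pt) : pt := (fst p + fst q, snd p + snd q).
Definition psub (p q : pt) : pt := (fst p - fst q, snd p - snd q).
Definition pscal (a : R) (p : pt) : pt := (a * fst p, a * snd p).
Definition dot (p q : pt) : R := fst p * fst q + snd p * snd q.
(* z-component of the cross product; cross u v > 0 iff v is to the left of u *)
Definition cross (p q : pt) : R := fst p * snd q - snd p * fst q.
Definition dist2 (p q : pt) : R := sqrt (dot (psub p q) (psub p q)).

Definition inD (p : pt) : Prop := dot p p < 1.

(* S^1 = R/Z via the counterclockwise normalized angle: t |-> e(t). *)
Definition e (t : R) : pt := (cos (2 * PI * t), sin (2 * PI * t)).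

Definition filled_triangle (P1 P2 P3 : pt) (X : pt) : Prop :=
  exists a b c : R, 0 <= a /\ 0 <= b /\ 0 <= c /\ a + b + c = 1 /\
    X = padd (pscal a P1) (padd (pscal b P2) (pscal c P3)).

Definition collinear (P1 P2 P3 : pt) : Prop :=
  cross (psub P2 P1) (psub P3 P1) = 0.

(* psi_U(v) = w : w <> v, the line vw meets U, and U lies in the closed
   half-plane to the left of the directed line from v to w. *)
Definition is_psi (U : pt -> Prop) (v w : pt) : Prop :=
  w <> v /\
  (exists p, U p /\ cross (psub w v) (psub p v) = 0) /\
  (forall p, U p -> 0 <= cross (psub w v) (psub p v)).

Definition is_normalized_lift_psi (U : pt -> Prop) (F : R -> R) : Prop :=
  continuity F /\
  (forall t, is_psi U (e t) (e (F t))) /\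
  0 <= F 0 < 1.

(* Endpoints v1, v2 of the chord through distinct P, Q in D: the points
   P + s (Q - P) with |P + s(Q-P)| = 1, s the two roots of
   a s^2 + 2 b s + c = 0. *)
Definition chord_s (P Q : pt) (sgn : R) : R :=
  let a := dot (psub Q P) (psub Q P) in
  let b := dot P (psub Q P) in
  let c := dot P P - 1 in
  (- b + sgn * sqrt (b * b - a * c)) / a.
Definition chord_v1 (P Q : pt) : pt := padd P (pscal (chord_s P Q (-1)) (psub Q P)).
Definition chord_v2 (P Q : pt) : pt := padd P (pscal (chord_s P Q 1) (psub Q P)).

Definition dK (P Q : pt) : R :=
  let v1 := chord_v1 P Q in
  let v2 := chord_v2 P Q in
  / 2 * Rabs (ln ((dist2 v1 Q * dist2 v2 P) / (dist2 v1 P * dist2 v2 Q))).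

Definition DeltaK (n : nat) (P Q : pt) : R :=
  ln ((exp (INR n * dK P Q) + 1) / (exp (INR n * dK P Q) - 1)).

Definition on_chord (P Q S : pt) : Prop :=
  inD S /\ exists s : R, S = padd P (pscal s (psub Q P)).

(* delta(P,Q,R) = min { d'(R,S) : S on the chord through P,Q }
   (taken as the infimum, which is attained). *)
Definition deltaK (P Q Rp : pt) : Rbar :=
  Glb_Rbar (fun x => exists S, on_chord P Q S /\ x = dK Rp S).

(* Main.v *)
Require Import Defs.
From Stdlib Require Import Reals Lra Lia ZArith.
From Coquelicot Require Import Coquelicot.
Open Scope R_scope.

(** The lift of [psi] is the pointwise minimum of the lifts [f_i] of the
    involutions of the circle that swap the ends of each chord through [P_i].
    On half-angle vectors [f_i] is a trace-free matrix [M_i] (the half-turn about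
    [P_i]), and [f_i (f_i x) = x + 1].  The fifth iterate of the minimum is a
    word of length 5 in the [f_i]; up to rotation and cancellation of squares
    such a word is [f_a f_b f_a f_b f_c] or [f_a f_b f_c].  By Cayley-Hamilton
    the first has trace [tr (M_a M_b) tr (M_a M_b M_c)], and it is elliptic
    exactly when [sinh (2 d'(P_a, P_b)) sinh (delta (P_a, P_b, P_c)) < 1], which
    is the hypothesis.  Elliptic words have no fixed point on the circle, and at
    the preimage under [f_c] of an end of the chord [P_a P_b] the word advances by
    more than 2, hence it does so everywhere.  Compactness then gives a rotation
    number strictly above 2/5. *)

(** * Lifts of circle involutions *)

(** The square is one full turn, not the identity: this selects the lift in which the
    fixed-point-free involution of the circle goes half way round. *)
Definition involutive_lift (f : R -> R) : Prop :=
  continuity f /\ (forall x y, x < y -> f x < f y) /\ (forall x, f (f x) = x + 1).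

(** If [f x <= x], monotonicity would give [f (f x) <= f x <= x], against [f (f x) = x + 1]. *)
Lemma involutive_lift_gt f x : involutive_lift f -> x < f x.
Proof.
  intros (_ & Hi & Hf). destruct (Rlt_le_dec x (f x)) as [H|[H|H]]; auto.
  - pose proof (Hi _ _ H). rewrite Hf in H0. lra.
  - pose proof (Hf x). rewrite H, H in H0. lra.
Qed.

Lemma involutive_lift_shift f x : involutive_lift f -> f (x + 1) = f x + 1.
Proof. intros (_ & _ & Hf). now rewrite <- (Hf x), <- (Hf (f x)). Qed.

Lemma involutive_lift_reflect f x y : involutive_lift f -> f x < f y -> x < y.
Proof.
  intros (_ & Hi & _) H. destruct (Rlt_le_dec x y) as [|[H1|H1]]; auto.
  - apply Hi in H1; lra.
  - subst; lra.
Qed.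

Lemma IVT_zero_between f x y : continuity f -> 0 < f x -> f y <= 0 -> exists z, f z = 0.
Proof.
  intros Hc Hx [Hy|Hy]; [|now exists y].
  destruct (Rtotal_order x y) as [H|[H|H]].
  - destruct (IVT (fun t => - f t) x y) as [z [_ Hz]]; try lra.
    + now apply continuity_opp.
    + exists z; lra.
  - subst; lra.
  - destruct (IVT f y x Hc H Hy Hx) as [z [_ Hz]]. now exists z.
Qed.

(** If [f 0 < g 0], then at [f 0] the order is reversed: [g (f 0) < g (g 0) = 1 = f (f 0)]. The
    intermediate value theorem gives a crossing. *)
Lemma involutive_lift_coincidence f g :
  involutive_lift f -> involutive_lift g -> exists x, f x = g x.
Proof.
  intros Lf Lg. pose proof Lf as (Cf & If & Hf). pose proof Lg as (Cg & Ig & Hg).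
  assert (Hc : continuity (fun t => f t - g t)) by now apply continuity_minus.
  assert (Hc' : continuity (fun t => g t - f t)) by now apply continuity_minus.
  destruct (Rtotal_order (f 0) (g 0)) as [H|[H|H]].
  - destruct (IVT_zero_between (fun t => g t - f t) 0 (f 0) Hc') as [z Hz]; try lra.
    + rewrite Hf. pose proof (Ig _ _ H). rewrite Hg in H0. lra.
    + exists z; lra.
  - now exists 0.
  - destruct (IVT_zero_between (fun t => f t - g t) 0 (g 0) Hc) as [z Hz]; try lra.
    + rewrite Hg. pose proof (If _ _ H). rewrite Hf in H0. lra.
    + exists z; lra.
Qed.

(* At the endpoint of the chord through the two centres, [f] after [g] is the
   translation by 1; this fixes the integer below the displacement of the word. *)
Lemma word3_gt f g h :
  involutive_lift f -> involutive_lift g -> involutive_lift h ->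
  (forall x, f (g (h x)) <> x + 1) -> forall x, x + 1 < f (g (h x)).
Proof.
  intros Lf Lg Lh Hne x.
  destruct (involutive_lift_coincidence f g Lf Lg) as [z Hz].
  pose proof Lf as (Cf & _ & Hf). pose proof Lg as (Cg & _ & _). pose proof Lh as (Ch & _ & Hh).
  destruct (Rlt_le_dec (x + 1) (f (g (h x)))) as [|H]; auto. exfalso.
  (* [h] sends [h (z - 1)] to [z], so there the word has the value [z + 1], which is above
     [h (z - 1) + 1] because [h] moves points forward. *)
  destruct (IVT_zero_between (fun t => f (g (h t)) - (t + 1)) (h (z - 1)) x) as [y Hy].
  - apply continuity_minus; [|apply derivable_continuous; reg].
    apply (continuity_comp (fun t => g (h t)) f); auto. now apply (continuity_comp h g).
  - rewrite Hh. replace (z - 1 + 1) with z by ring. rewrite <- Hz, Hf.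
    pose proof (involutive_lift_gt h (h (z - 1)) Lh). rewrite Hh in H0. lra.
  - lra.
  - apply (Hne y). lra.
Qed.

(** As for three letters, except that the pair [f], [g] now acts twice and carries [z] to
    [z + 2]. *)
Lemma word5_gt f g h :
  involutive_lift f -> involutive_lift g -> involutive_lift h ->
  (forall x, f (g (f (g (h x)))) <> x + 2) -> forall x, x + 2 < f (g (f (g (h x)))).
Proof.
  intros Lf Lg Lh Hne x.
  destruct (involutive_lift_coincidence f g Lf Lg) as [z Hz].
  pose proof Lf as (Cf & _ & Hf). pose proof Lg as (Cg & _ & _). pose proof Lh as (Ch & _ & Hh).
  destruct (Rlt_le_dec (x + 2) (f (g (f (g (h x)))))) as [|H]; auto. exfalso.
  destruct (IVT_zero_between (fun t => f (g (f (g (h t)))) - (t + 2)) (h (z - 1)) x) as [y Hy].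
  - apply continuity_minus; [|apply derivable_continuous; reg].
    apply (continuity_comp (fun t => g (f (g (h t)))) f); auto.
    apply (continuity_comp (fun t => f (g (h t))) g); auto.
    apply (continuity_comp (fun t => g (h t)) f); auto. now apply (continuity_comp h g).
  - rewrite Hh. replace (z - 1 + 1) with z by ring.
    rewrite <- Hz, Hf, involutive_lift_shift, <- Hz, involutive_lift_shift, Hf by auto.
    pose proof (involutive_lift_gt h (h (z - 1)) Lh). rewrite Hh in H0. lra.
  - lra.
  - apply (Hne y). lra.
Qed.

(** * Words of length three and five in three involutive lifts *)

Inductive vertex := V1 | V2 | V3.

Section Words.

Variable f : vertex -> R -> R.
Hypothesis Lf : forall a, involutive_lift (f a).
Hypothesis H3 : forall a b c, a <> b -> b <> c -> a <> c ->
  forall x, x + 1 < f a (f b (f c x)).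
Hypothesis H5 : forall a b c, a <> b -> b <> c -> a <> c ->
  forall x, x + 2 < f a (f b (f a (f b (f c x)))).

Let good5 a b c d e := forall x, x + 2 < f a (f b (f c (f d (f e x)))).

(** A square of a letter is the translation by 1 and the remaining letter moves forward. In [aba]
    the middle letter moves [f a x] forward, and [f a (f a x) = x + 1]. Only three distinct letters
    require [H3]. *)
Lemma all_words3 a b c x : x + 1 < f a (f b (f c x)).
Proof.
  assert (Hsq : forall a x, f a (f a x) = x + 1) by (intros a'; apply Lf).
  assert (Haa : forall a b x, x + 1 < f a (f a (f b x))).
  { intros a' b' x'. rewrite Hsq. pose proof (involutive_lift_gt (f b') x' (Lf b')). lra. }
  assert (Hbb : forall a b x, x + 1 < f a (f b (f b x))).
  { intros a' b' x'. rewrite Hsq, involutive_lift_shift by auto.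
    pose proof (involutive_lift_gt (f a') x' (Lf a')). lra. }
  assert (Haba : forall a b x, x + 1 < f a (f b (f a x))).
  { intros a' b' x'. rewrite <- (Hsq a' x'). apply (Lf a'), involutive_lift_gt, Lf. }
  destruct a, b, c; auto; apply H3; discriminate.
Qed.

Lemma good5_repeat a b c d : good5 a a b c d.
Proof.
  intros x. pose proof (Lf a) as (_ & _ & Hf). rewrite Hf.
  pose proof (all_words3 b c d x). lra.
Qed.

(** The rotated word is the conjugate of the original by [f a], which is increasing and commutes
    with integer translations. *)
Lemma good5_rotate a b c d e : good5 a b c d e -> good5 b c d e a.
Proof.
  intros H x. apply (involutive_lift_reflect (f a)); [apply Lf|].
  replace (x + 2) with (x + 1 + 1) by ring. rewrite !involutive_lift_shift by apply Lf.
  specialize (H (f a x)). lra.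
Qed.

(* A cyclic word of length 5 in three letters without repeated neighbours is
   a rotation of [ababc]. *)
Lemma all_words5 a b c d e x : x + 2 < f a (f b (f c (f d (f e x)))).
Proof.
  revert x. change (good5 a b c d e).
  assert (Hababc : forall a b c, a <> b -> b <> c -> a <> c -> good5 a b a b c) by exact H5.
  (* Each of the 243 words is rotated at most four times, until it begins with a square or reads
     [ababc]. *)
  destruct a, b, c, d, e;
  first [ apply good5_repeat | apply Hababc; discriminate
    | apply good5_rotate; first [ apply good5_repeat | apply Hababc; discriminate
    | apply good5_rotate; first [ apply good5_repeat | apply Hababc; discriminate
    | apply good5_rotate; first [ apply good5_repeat | apply Hababc; discriminate
    | apply good5_rotate; first [ apply good5_repeat | apply Hababc; discriminate ]]]]].
Qed.

End Words.

(** * Rotation numbers *)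

Section Rotation.

Variable F : R -> R.
Hypothesis Fc : continuity F.
Hypothesis Fi : forall x y, x <= y -> F x <= F y.
Hypothesis F1 : forall x, F (x + 1) = F x + 1.

Lemma iter_incr n x y : x <= y -> Nat.iter n F x <= Nat.iter n F y.
Proof. intros H. induction n; simpl; auto. Qed.

Lemma iter_shift n x : Nat.iter n F (x + 1) = Nat.iter n F x + 1.
Proof. induction n; simpl; auto. now rewrite IHn, F1. Qed.

Lemma iter_shift_nat n k x : Nat.iter n F (x + INR k) = Nat.iter n F x + INR k.
Proof.
  induction k as [|k IH]; [simpl; now rewrite !Rplus_0_r|].
  rewrite S_INR. replace (x + (INR k + 1)) with (x + INR k + 1) by ring.
  rewrite iter_shift, IH. ring.
Qed.

Lemma iter_shift_Z n k x : Nat.iter n F (x + IZR k) = Nat.iter n F x + IZR k.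
Proof.
  destruct (Z_le_gt_dec 0 k) as [H|H].
  - rewrite <- (Z2Nat.id k), <- INR_IZR_INZ by lia. apply iter_shift_nat.
  - pose proof (iter_shift_nat n (Z.to_nat (- k)) (x + IZR k)) as E.
    rewrite INR_IZR_INZ, Z2Nat.id, opp_IZR in E by lia.
    replace (x + IZR k + - IZR k) with x in E by ring. lra.
Qed.

Lemma iter_displacement n x :
  Rabs (Nat.iter n F x - x - Nat.iter n F 0) <= 1.
Proof.
  (* [k] is the floor of [x], so that [x - IZR k] lies in the period [0, 1). *)
  destruct (archimed x) as [Ha Hb]. set (k := (up x - 1)%Z).
  assert (Hk : IZR k = IZR (up x) - 1) by (unfold k; now rewrite minus_IZR).
  assert (Hx : x = (x - IZR k) + IZR k) by ring.
  rewrite Hx at 1. rewrite iter_shift_Z.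
  pose proof (iter_incr n 0 (x - IZR k) ltac:(lra)).
  pose proof (iter_incr n (x - IZR k) (0 + 1) ltac:(lra)). rewrite iter_shift in H0.
  apply Rabs_le. lra.
Qed.

Let a n := Nat.iter n F 0.

(** Each of the [n] blocks of [m] iterates advances by [a m] with an error of at most 1. *)
Lemma iter_quasi_additive n m : Rabs (a (n * m) - INR n * a m) <= INR n.
Proof.
  induction n as [|n IH]; [simpl; unfold a; simpl; rewrite Rmult_0_l, Rminus_0_r, Rabs_R0; lra|].
  unfold a at 1. simpl Nat.mul. rewrite Nat.iter_add. fold (a (n * m)).
  pose proof (iter_displacement m (a (n * m))) as H. fold (a m) in H.
  rewrite S_INR. apply Rabs_le_between in IH. apply Rabs_le_between in H.
  apply Rabs_le. lra.
Qed.

(** Both [INR n * a m] and [INR m * a n] approximate [a (n * m)]; this makes the averages a Cauchy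
    sequence. *)
Lemma iter_average_diff n m : (0 < n)%nat -> (0 < m)%nat ->
  Rabs (a n / INR n - a m / INR m) <= / INR n + / INR m.
Proof.
  intros Hn Hm. apply lt_0_INR in Hn. apply lt_0_INR in Hm.
  pose proof (iter_quasi_additive n m) as A. pose proof (iter_quasi_additive m n) as B.
  rewrite Nat.mul_comm in B.
  apply Rabs_le_between in A. apply Rabs_le_between in B.
  assert (E : a n / INR n - a m / INR m = (INR m * a n - INR n * a m) / (INR n * INR m))
    by (field; lra).
  assert (E' : / INR n + / INR m = (INR n + INR m) / (INR n * INR m)) by (field; lra).
  assert (0 < / (INR n * INR m)) by (apply Rinv_0_lt_compat, Rmult_lt_0_compat; lra).
  rewrite E, E'. unfold Rdiv. rewrite Rabs_mult, (Rabs_pos_eq (/ _)) by lra.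
  apply Rmult_le_compat_r; [lra|]. apply Rabs_le. lra.
Qed.

Lemma is_lim_seq_inv_INR c : is_lim_seq (fun n => c / INR n) 0.
Proof.
  replace (Finite 0) with (Rbar_mult c 0) by (simpl; f_equal; ring).
  apply is_lim_seq_scal_l.
  replace (Finite 0) with (Rbar_inv p_infty) by reflexivity.
  apply is_lim_seq_inv; [apply is_lim_seq_INR|discriminate].
Qed.

Lemma rotation_number_exists :
  exists rho : R, forall x, is_lim_seq (fun n => (Nat.iter n F x - x) / INR n) rho.
Proof.
  assert (Hex : ex_finite_lim_seq (fun n => a n / INR n)).
  { apply ex_lim_seq_cauchy_corr. intros eps.
    assert (He : 0 < eps / 2) by (destruct eps; simpl; lra).
    destruct (archimed_cor1 _ He) as [N [HN HN0]].
    assert (Hinv : forall k, (N <= k)%nat -> / INR k <= / INR N).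
    { intros k Hk. apply Rinv_le_contravar; [now apply lt_0_INR|now apply le_INR]. }
    exists N. intros n m Hn Hm.
    eapply Rle_lt_trans; [apply iter_average_diff; lia|].
    pose proof (Hinv n Hn). pose proof (Hinv m Hm). lra. }
  destruct Hex as [rho Hrho]. exists rho. intros x.
  apply (is_lim_seq_le_le (fun n => a n / INR n + (- 1) / INR n) _
                          (fun n => a n / INR n + 1 / INR n)).
  - intros n. pose proof (iter_displacement n x) as H. fold (a n) in H.
    apply Rabs_le_between in H. unfold Rdiv. rewrite <- !Rmult_plus_distr_r.
    assert (0 <= / INR n).
    (* At [n = 0] the value [/ 0] is 0, so the bounds hold there too. *)
    { destruct n; [simpl; rewrite Rinv_0; lra|].
      left. apply Rinv_0_lt_compat, lt_0_INR; lia. }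
    split; apply Rmult_le_compat_r; lra.
  - replace (Finite rho) with (Finite (rho + 0)) by (f_equal; ring).
    apply is_lim_seq_plus'; [exact Hrho|apply is_lim_seq_inv_INR].
  - replace (Finite rho) with (Finite (rho + 0)) by (f_equal; ring).
    apply is_lim_seq_plus'; [exact Hrho|apply is_lim_seq_inv_INR].
Qed.

Lemma iter_continuity n : continuity (Nat.iter n F).
Proof.
  induction n as [|n IH]; simpl.
  - apply derivable_continuous, derivable_id.
  - now apply (continuity_comp (Nat.iter n F) F).
Qed.

(** The displacement is continuous and 1-periodic, so its minimum on [0, 1] is its minimum
    everywhere. *)
Lemma iter_advance_gap q p : (forall x, x + INR p < Nat.iter q F x) ->
  exists eps, 0 < eps /\ forall x, x + INR p + eps <= Nat.iter q F x.
Proof.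
  intros H.
  destruct (continuity_ab_min (fun x => Nat.iter q F x - x) 0 1 ltac:(lra)) as [m [Hm _]].
  { intros c _. apply continuity_pt_minus; [apply iter_continuity|].
    apply derivable_continuous_pt, derivable_pt_id. }
  exists (Nat.iter q F m - m - INR p). split; [specialize (H m); lra|].
  intros x. destruct (archimed x) as [Ha Hb]. set (k := (up x - 1)%Z).
  assert (Hk : IZR k = IZR (up x) - 1) by (unfold k; now rewrite minus_IZR).
  specialize (Hm (x - IZR k) ltac:(lra)).
  pose proof (iter_shift_Z q k (x - IZR k)) as E.
  replace (x - IZR k + IZR k) with x in E by ring. lra.
Qed.

Lemma rotation_number_gt q p (rho x : R) : (0 < q)%nat ->
  (forall x, x + INR p < Nat.iter q F x) ->
  is_lim_seq (fun n => (Nat.iter n F x - x) / INR n) rho -> INR p / INR q < rho.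
Proof.
  intros Hq Hadv Hlim. destruct (iter_advance_gap q p Hadv) as [eps [He Hgap]].
  assert (Hq' : 0 < INR q) by now apply lt_0_INR.
  assert (Hit : forall n, x + INR n * (INR p + eps) <= Nat.iter (n * q) F x).
  { induction n as [|n IH]; [simpl; lra|].
    simpl Nat.mul. rewrite Nat.iter_add, S_INR.
    specialize (Hgap (Nat.iter (n * q) F x)). lra. }
  apply Rlt_le_trans with ((INR p + eps) / INR q).
  { apply Rmult_lt_compat_r; [now apply Rinv_0_lt_compat|lra]. }
  (* The subsequence starts at index [q], since the bound fails at index 0, where the quotient is
     0. *)
  assert (Hsub : is_lim_seq (fun n => (Nat.iter (S n * q) F x - x) / INR (S n * q)) rho).
  { apply (is_lim_seq_subseq (fun n => (Nat.iter n F x - x) / INR n) rho (fun n => S n * q)%nat); auto.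
    apply eventually_subseq. intros n. nia. }
  refine (is_lim_seq_le (fun _ => (INR p + eps) / INR q) _
           (Finite ((INR p + eps) / INR q)) (Finite rho) _ (is_lim_seq_const _) Hsub).
  intros n. specialize (Hit (S n)). rewrite mult_INR.
  assert (0 < INR (S n)) by (apply lt_0_INR; lia).
  apply (Rmult_le_reg_r (INR (S n) * INR q)); [now apply Rmult_lt_0_compat|].
  replace ((INR p + eps) / INR q * (INR (S n) * INR q)) with (INR (S n) * (INR p + eps))
    by (field; lra).
  replace ((Nat.iter (S n * q) F x - x) / (INR (S n) * INR q) * (INR (S n) * INR q))
    with (Nat.iter (S n * q) F x - x) by (field; lra).
  lra.
Qed.

End Rotation.

(** * The circle involution of a point *)

(** The circle is the projective line of these half-angle vectors: [t] and [t + 1] give opposite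
    vectors, and matrices act projectively. *)
Definition halfdir (t : R) : pt := (cos (PI * t), sin (PI * t)).

Definition mat := (R * R * R * R)%type.
Definition mapp (M : mat) (u : pt) : pt :=
  let '(m11, m12, m21, m22) := M in
  (m11 * fst u + m12 * snd u, m21 * fst u + m22 * snd u).
Definition mmul (M N : mat) : mat :=
  let '(m11, m12, m21, m22) := M in
  let '(n11, n12, n21, n22) := N in
  (m11 * n11 + m12 * n21, m11 * n12 + m12 * n22,
   m21 * n11 + m22 * n21, m21 * n12 + m22 * n22).
Definition mtr (M : mat) : R := let '(m11, _, _, m22) := M in m11 + m22.
Definition mdet (M : mat) : R := let '(m11, m12, m21, m22) := M in m11 * m22 - m12 * m21.

Lemma mapp_mul M N u : mapp (mmul M N) u = mapp M (mapp N u).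
Proof.
  destruct M as [[[? ?] ?] ?], N as [[[? ?] ?] ?], u. simpl. f_equal; ring.
Qed.

Lemma mdet_mul M N : mdet (mmul M N) = mdet M * mdet N.
Proof. destruct M as [[[? ?] ?] ?], N as [[[? ?] ?] ?]. simpl. ring. Qed.

Lemma mapp_scal M k u : mapp M (pscal k u) = pscal k (mapp M u).
Proof. destruct M as [[[? ?] ?] ?], u. unfold pscal. simpl. f_equal; ring. Qed.

(** A negative discriminant makes the characteristic polynomial positive at every real [k], so
    [M - k] is invertible; Cramer's rule then kills [u]. *)
Lemma elliptic_no_eigenvector M k u :
  mtr M * mtr M < 4 * mdet M -> mapp M u = pscal k u -> u = (0, 0).
Proof.
  destruct M as [[[m11 m12] m21] m22], u as [x y]. unfold pscal. simpl.
  intros H E. injection E as E1 E2.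
  assert (Hd : 0 < (m11 - k) * (m22 - k) - m12 * m21).
  { pose proof (Rle_0_sqr (2 * k - (m11 + m22))) as S. unfold Rsqr in S. nra. }
  assert (Hx : ((m11 - k) * (m22 - k) - m12 * m21) * x = 0).
  { replace (_ * x) with ((m22 - k) * (m11 * x + m12 * y - k * x)
      - m12 * (m21 * x + m22 * y - k * y)) by ring. rewrite E1, E2. ring. }
  assert (Hy : ((m11 - k) * (m22 - k) - m12 * m21) * y = 0).
  { replace (_ * y) with ((m11 - k) * (m21 * x + m22 * y - k * y)
      - m21 * (m11 * x + m12 * y - k * x)) by ring. rewrite E1, E2. ring. }
  apply Rmult_integral in Hx. apply Rmult_integral in Hy.
  f_equal; lra.
Qed.

(* The chord of angles 2a, 2b is x cos (a+b) + y sin (a+b) = cos (a-b); solving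
   for (cos b, sin b) when the chord passes through P gives this matrix. *)
Definition half_turn_mx (P : pt) : mat := (snd P, - (1 + fst P), 1 - fst P, - snd P).

(** Cotangent of the angle at [e t] between the counterclockwise tangent and the chord through [P]:
    the tangential part of [P - e t] over its inward normal part. That angle is half the central
    angle of the chord. *)
Definition cot_angle (P : pt) (t : R) : R := cross (e t) P / (1 - dot P (e t)).

(** The arccotangent with values between 0 and [PI], divided by [PI]: as a half central angle it
    measures the arc in full turns. *)
Definition arccot_turn (m : R) : R := 1 / 2 - atan m / PI.

Definition turn (P : pt) (t : R) : R := t + arccot_turn (cot_angle P t).

Lemma arccot_turn_bounds m : 0 < arccot_turn m < 1.
Proof.
  unfold arccot_turn. pose proof PI_RGT_0. destruct (atan_bound m) as [H1 H2].
  assert (atan m / PI < 1 / 2).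
  { apply (Rmult_lt_reg_r PI); auto. unfold Rdiv at 1. rewrite Rmult_assoc, Rinv_l; lra. }
  assert (- (1 / 2) < atan m / PI).
  { apply (Rmult_lt_reg_r PI); auto. unfold Rdiv at 2. rewrite Rmult_assoc, Rinv_l; lra. }
  lra.
Qed.

Lemma arccot_turn_decr m n : m <= n -> arccot_turn n <= arccot_turn m.
Proof.
  intros [H|H]; [|subst; lra]. apply atan_increasing in H. unfold arccot_turn, Rdiv.
  pose proof (Rinv_0_lt_compat PI PI_RGT_0). nra.
Qed.

Lemma sin_arccot_turn m : sin (PI * arccot_turn m) = / sqrt (1 + m * m).
Proof.
  unfold arccot_turn. pose proof PI_RGT_0.
  replace (PI * (1 / 2 - atan m / PI)) with (PI / 2 - atan m) by (field; lra).
  rewrite sin_shift, cos_atan. unfold Rsqr, Rdiv. ring.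
Qed.

Lemma cos_arccot_turn m : cos (PI * arccot_turn m) = m / sqrt (1 + m * m).
Proof.
  unfold arccot_turn. pose proof PI_RGT_0.
  replace (PI * (1 / 2 - atan m / PI)) with (PI / 2 - atan m) by (field; lra).
  rewrite cos_shift, sin_atan. reflexivity.
Qed.

Lemma arccot_turn_continuity : continuity arccot_turn.
Proof.
  unfold arccot_turn. intros x. apply continuity_pt_minus.
  - apply continuity_pt_const. now intros ? ?.
  - unfold Rdiv. apply continuity_pt_mult; [|apply continuity_pt_const; now intros ? ?].
    apply derivable_continuous_pt. exists (/ (1 + x ^ 2)).
    apply derivable_pt_lim_atan.
Qed.

Lemma norm_e t : dot (e t) (e t) = 1.
Proof. unfold e, dot. simpl. pose proof (sin2_cos2 (2 * PI * t)). unfold Rsqr in H. lra. Qed.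

Lemma e_halfdir t : e t =
  (fst (halfdir t) * fst (halfdir t) - snd (halfdir t) * snd (halfdir t),
   2 * (fst (halfdir t) * snd (halfdir t))).
Proof.
  unfold e, halfdir; simpl. replace (2 * PI * t) with (2 * (PI * t)) by ring.
  rewrite cos_2a, sin_2a. f_equal. ring.
Qed.

Lemma norm_halfdir t : fst (halfdir t) * fst (halfdir t) + snd (halfdir t) * snd (halfdir t) = 1.
Proof. unfold halfdir. simpl. pose proof (sin2_cos2 (PI * t)). unfold Rsqr in H. lra. Qed.

Lemma dot_lt_1 P Q : inD P -> dot Q Q <= 1 -> dot P Q < 1.
Proof.
  unfold inD, dot. destruct P as [x y], Q as [z w]. simpl. intros.
  pose proof (Rle_0_sqr (x - z)). pose proof (Rle_0_sqr (y - w)). unfold Rsqr in *. lra.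
Qed.

Lemma cot_angle_continuity P : inD P -> continuity (cot_angle P).
Proof.
  intros HP t. unfold cot_angle. apply continuity_pt_div.
  - apply derivable_continuous_pt. unfold cross, e; simpl. reg.
  - apply derivable_continuous_pt. unfold dot, e; simpl. reg.
  - pose proof (dot_lt_1 P (e t) HP ltac:(rewrite norm_e; lra)). lra.
Qed.

Lemma turn_continuity P : inD P -> continuity (turn P).
Proof.
  intros HP. unfold turn. apply continuity_plus.
  - apply derivable_continuous, derivable_id.
  - apply (continuity_comp (cot_angle P) arccot_turn).
    + now apply cot_angle_continuity.
    + apply arccot_turn_continuity.
Qed.

Lemma turn_bounds P t : t < turn P t < t + 1.
Proof. unfold turn. pose proof (arccot_turn_bounds (cot_angle P t)). lra. Qed.

Lemma half_turn_mx_halfdir P t : inD P ->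
  exists r, 0 < r /\ mapp (half_turn_mx P) (halfdir t) = pscal r (halfdir (turn P t)).
Proof.
  intros HP. pose proof (dot_lt_1 P (e t) HP ltac:(rewrite norm_e; lra)) as HA.
  set (A := 1 - dot P (e t)) in *. set (B := cross (e t) P).
  set (m := cot_angle P t). assert (Hm : B = A * m).
  { unfold m, cot_angle. fold A B. field. unfold A; lra. }
  assert (HA' : 0 < A) by (unfold A; lra).
  assert (Hs : 0 < sqrt (1 + m * m)) by (apply sqrt_lt_R0; nra).
  (* On [halfdir t], read as a complex number, the matrix multiplies by A (m + i); this is its
     modulus, and its argument is [PI * arccot_turn m]. *)
  exists (A * sqrt (1 + m * m)). split; [nra|].
  unfold turn. fold m. unfold halfdir at 2, pscal. rewrite Rmult_plus_distr_l.
  rewrite cos_plus, sin_plus, sin_arccot_turn, cos_arccot_turn.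
  assert (E1 : cos (PI * t) = fst (halfdir t)) by reflexivity.
  assert (E2 : sin (PI * t) = snd (halfdir t)) by reflexivity.
  rewrite E1, E2. pose proof (norm_halfdir t) as Hn.
  assert (HAE : A = 1 - dot P (e t)) by reflexivity.
  assert (HBE : B = cross (e t) P) by reflexivity.
  rewrite e_halfdir in HAE, HBE. unfold dot, cross in HAE, HBE.
  destruct P as [x y]. destruct (halfdir t) as [c s].
  simpl in *. set (q := sqrt (1 + m * m)) in *.
  f_equal.
  - replace (A * q * (c * (m / q) - s * / q)) with (A * m * c - A * s) by (field; lra).
    rewrite <- Hm, HBE, HAE.
    replace (y * c + - (1 + x) * s) with
      (y * (c * (c * c + s * s)) - s - x * (s * (c * c + s * s))) by (rewrite Hn; ring). ring.
  - replace (A * q * (s * (m / q) + c * / q)) with (A * m * s + A * c) by (field; lra).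
    rewrite <- Hm, HBE, HAE.
    replace ((1 - x) * c + - y * s) with
      (c - x * (c * (c * c + s * s)) - y * (s * (c * c + s * s))) by (rewrite Hn; ring). ring.
Qed.

Lemma cross_halfdir s t : cross (halfdir s) (halfdir t) = sin (PI * (t - s)).
Proof.
  unfold cross, halfdir; simpl. replace (PI * (t - s)) with (PI * t - PI * s) by ring.
  rewrite sin_minus. ring.
Qed.

Lemma cross_mapp M u v : cross (mapp M u) (mapp M v) = mdet M * cross u v.
Proof. destruct M as [[[? ?] ?] ?], u, v. unfold cross. simpl. ring. Qed.

Lemma cross_scal a b u v : cross (pscal a u) (pscal b v) = a * b * cross u v.
Proof. destruct u, v. unfold cross, pscal. simpl. ring. Qed.

Lemma mdet_half_turn_mx P : mdet (half_turn_mx P) = 1 - dot P P.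
Proof. unfold half_turn_mx, dot. simpl. ring. Qed.

Lemma half_turn_mx_sq P u :
  mapp (half_turn_mx P) (mapp (half_turn_mx P) u) = pscal (- (1 - dot P P)) u.
Proof. destruct u, P. unfold pscal, dot; simpl. f_equal; ring. Qed.

Lemma sin_turn_pos z : 0 < z < 1 -> 0 < sin (PI * z).
Proof. intros H. pose proof PI_RGT_0. apply sin_gt_0; nra. Qed.

(** The matrix has positive determinant, so it preserves the sign of the cross product, which on
    half-angle vectors is the sine of [PI] times the difference of parameters. *)
Lemma turn_incr_local P x y : inD P -> x < y < x + 1 -> turn P x < turn P y.
Proof.
  intros HP [Hxy Hy1].
  destruct (half_turn_mx_halfdir P x HP) as [r [Hr Er]].
  destruct (half_turn_mx_halfdir P y HP) as [q [Hq Eq]].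
  pose proof (cross_mapp (half_turn_mx P) (halfdir x) (halfdir y)) as E.
  rewrite Er, Eq, cross_scal, mdet_half_turn_mx, !cross_halfdir in E.
  pose proof (sin_turn_pos (y - x) ltac:(lra)) as Hs. unfold inD in HP.
  assert (Hpos : 0 < sin (PI * (turn P y - turn P x))).
  { apply (Rmult_lt_reg_l (r * q)); [now apply Rmult_lt_0_compat|].
    rewrite E, Rmult_0_r. apply Rmult_lt_0_compat; lra. }
  destruct (Rlt_le_dec (turn P x) (turn P y)) as [|H]; auto. exfalso.
  pose proof (turn_bounds P x). pose proof (turn_bounds P y).
  assert (0 <= sin (PI * (turn P x - turn P y))).
  { pose proof PI_RGT_0. apply sin_ge_0; nra. }
  replace (PI * (turn P x - turn P y)) with (- (PI * (turn P y - turn P x))) in H2 by ring.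
  rewrite sin_neg in H2. lra.
Qed.

(** The matrix squares to a scalar, so the total advance is an integer; it lies strictly between 0
    and 2. *)
Lemma turn_involutive P x : inD P -> turn P (turn P x) = x + 1.
Proof.
  intros HP.
  destruct (half_turn_mx_halfdir P x HP) as [r [Hr Er]].
  destruct (half_turn_mx_halfdir P (turn P x) HP) as [q [Hq Eq]].
  pose proof (half_turn_mx_sq P (halfdir x)) as E.
  rewrite Er, mapp_scal, Eq in E.
  assert (C : cross (halfdir x) (pscal r (pscal q (halfdir (turn P (turn P x))))) = 0).
  { rewrite E. unfold cross, pscal; simpl; ring. }
  assert (C' : r * q * cross (halfdir x) (halfdir (turn P (turn P x))) = 0).
  { rewrite <- C. unfold cross, pscal; simpl; ring. }
  rewrite cross_halfdir in C'.
  assert (Hz : sin (PI * (turn P (turn P x) - x)) = 0).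
  { apply Rmult_integral in C'. destruct C' as [C'|]; auto. nra. }
  pose proof (turn_bounds P x). pose proof (turn_bounds P (turn P x)).
  set (d := turn P (turn P x) - x) in *.
  assert (0 < d < 2) by (unfold d; lra).
  destruct (Rtotal_order d 1) as [H2|[H2|H2]].
  - pose proof (sin_turn_pos d ltac:(lra)). lra.
  - unfold d in H2; lra.
  - pose proof (sin_turn_pos (d - 1) ltac:(lra)).
    replace (PI * d) with (PI * (d - 1) + PI) in Hz by ring. rewrite neg_sin in Hz. lra.
Qed.

Lemma involutive_lift_turn P : inD P -> involutive_lift (turn P).
Proof.
  intros HP. split; [now apply turn_continuity|split].
  - intros x y H. destruct (Rlt_le_dec y (x + 1)) as [H1|H1].
    + now apply turn_incr_local.
    + pose proof (turn_bounds P x). pose proof (turn_bounds P y). lra.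
  - intros x. now apply turn_involutive.
Qed.

(** * Ellipticity of the words [abc] and [ababc] *)

Lemma halfdir_neq0 t : halfdir t <> (0, 0).
Proof. intros E. pose proof (norm_halfdir t) as H. rewrite E in H. simpl in H. lra. Qed.

Lemma halfdir_shift1 t : halfdir (t + 1) = pscal (-1) (halfdir t).
Proof.
  unfold halfdir, pscal; simpl. rewrite Rmult_plus_distr_l, Rmult_1_r, neg_sin, neg_cos.
  f_equal; ring.
Qed.

(** Equality would make [halfdir x] a real eigenvector of the product matrix, whose trace is
    [2 * cross (psub B A) (psub C A)]; the inequality says that this matrix is elliptic. *)
Lemma turn3_neq A B C x : inD A -> inD B -> inD C ->
  cross (psub B A) (psub C A) * cross (psub B A) (psub C A)
    < (1 - dot A A) * (1 - dot B B) * (1 - dot C C) ->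
  turn A (turn B (turn C x)) <> x + 1.
Proof.
  intros HA HB HC Hell E.
  destruct (half_turn_mx_halfdir C x HC) as [r [_ Er]].
  destruct (half_turn_mx_halfdir B (turn C x) HB) as [q [_ Eq]].
  destruct (half_turn_mx_halfdir A (turn B (turn C x)) HA) as [p [_ Ep]].
  apply (halfdir_neq0 x).
  apply (elliptic_no_eigenvector
    (mmul (half_turn_mx A) (mmul (half_turn_mx B) (half_turn_mx C))) (- (p * q * r))).
  - rewrite !mdet_mul, !mdet_half_turn_mx.
    replace (mtr _) with (2 * cross (psub B A) (psub C A))
      by (unfold cross, psub; simpl; ring). lra.
  - rewrite !mapp_mul, Er, mapp_scal, Eq, !mapp_scal, Ep, E, halfdir_shift1.
    unfold pscal; simpl; f_equal; ring.
Qed.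

Lemma turn5_neq A B C x : inD A -> inD B -> inD C ->
  4 * ((1 - dot A B) * (1 - dot A B))
    * (cross (psub B A) (psub C A) * cross (psub B A) (psub C A))
    < ((1 - dot A A) * (1 - dot B B)) * ((1 - dot A A) * (1 - dot B B)) * (1 - dot C C) ->
  turn A (turn B (turn A (turn B (turn C x)))) <> x + 2.
Proof.
  intros HA HB HC Hell E.
  destruct (half_turn_mx_halfdir C x HC) as [r [_ Er]].
  destruct (half_turn_mx_halfdir B (turn C x) HB) as [q [_ Eq]].
  destruct (half_turn_mx_halfdir A (turn B (turn C x)) HA) as [p [_ Ep]].
  destruct (half_turn_mx_halfdir B (turn A (turn B (turn C x))) HB) as [q' [_ Eq']].
  destruct (half_turn_mx_halfdir A (turn B (turn A (turn B (turn C x)))) HA) as [p' [_ Ep']].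
  apply (halfdir_neq0 x).
  apply (elliptic_no_eigenvector
    (mmul (half_turn_mx A) (mmul (half_turn_mx B)
      (mmul (half_turn_mx A) (mmul (half_turn_mx B) (half_turn_mx C))))) (p * q * p' * q' * r)).
  - rewrite !mdet_mul, !mdet_half_turn_mx.
    replace (mtr _) with (- 4 * (1 - dot A B) * cross (psub B A) (psub C A))
      by (unfold cross, psub, dot; simpl; ring). lra.
  - replace (x + 2) with (x + 1 + 1) in E by ring.
    rewrite !mapp_mul, Er, mapp_scal, Eq, !mapp_scal, Ep, !mapp_scal, Eq', !mapp_scal, Ep', E.
    rewrite !halfdir_shift1. unfold pscal; simpl; f_equal; ring.
Qed.

(** * The hypothesis in coordinates *)

(* Minus the Gram determinant of (P, 1) and (Q, 1) for the Lorentz form. *)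
Definition lorentz_gram (P Q : pt) : R :=
  (1 - dot P Q) * (1 - dot P Q) - (1 - dot P P) * (1 - dot Q Q).

Lemma dot_psub_pos P Q : P <> Q -> 0 < dot (psub Q P) (psub Q P).
Proof.
  destruct P as [x y], Q as [z w]. intros Hne. unfold dot, psub; simpl.
  pose proof (Rle_0_sqr (z - x)) as Sx. pose proof (Rle_0_sqr (w - y)) as Sy.
  destruct (Req_dec (z - x) 0) as [H1|H1].
  - destruct (Req_dec (w - y) 0) as [H2|H2].
    + exfalso; apply Hne. f_equal; lra.
    + pose proof (Rsqr_pos_lt _ H2). unfold Rsqr in *. lra.
  - pose proof (Rsqr_pos_lt _ H1). unfold Rsqr in *. lra.
Qed.

(** Reverse Cauchy-Schwarz; the quantity is also the discriminant under the root in [chord_s]. *)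
Lemma lorentz_gram_pos P Q : inD P -> P <> Q -> 0 < lorentz_gram P Q.
Proof.
  intros HP Hne. apply dot_psub_pos in Hne. unfold inD in HP.
  replace (lorentz_gram P Q) with
    ((1 - dot P P) * dot (psub Q P) (psub Q P) + dot P (psub Q P) * dot P (psub Q P))
    by (unfold lorentz_gram, dot, psub; simpl; ring).
  pose proof (Rle_0_sqr (dot P (psub Q P))) as S. unfold Rsqr in S.
  pose proof (Rmult_lt_0_compat (1 - dot P P) _ ltac:(lra) Hne). lra.
Qed.

(* The Gram determinant of R, S and the polar L of the line PQ is minus a
   square, and L is orthogonal to S. *)
Lemma lorentz_gram_line P Q Rp s : let S := padd P (pscal s (psub Q P)) in
  cross (psub Q P) (psub Rp P) * cross (psub Q P) (psub Rp P) * (1 - dot S S)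
    <= lorentz_gram Rp S * lorentz_gram P Q.
Proof.
  intros S. destruct P as [p1 p2], Q as [q1 q2], Rp as [r1 r2].
  (* (l1, l2, l3) is the polar vector of the line PQ, Lorentz-orthogonal to (P, 1) and (Q, 1); [D]
     is its determinant with (R, 1) and (S, 1). *)
  set (l1 := p2 - q2). set (l2 := q1 - p1). set (l3 := q1 * p2 - p1 * q2).
  set (D := r1 * (snd S * l3 - l2) - r2 * (fst S * l3 - l1) + (fst S * l2 - snd S * l1)).
  assert (E : lorentz_gram (r1, r2) S * lorentz_gram (p1, p2) (q1, q2) =
    cross (psub (q1, q2) (p1, p2)) (psub (r1, r2) (p1, p2)) *
    cross (psub (q1, q2) (p1, p2)) (psub (r1, r2) (p1, p2)) * (1 - dot S S) + D * D).
  { unfold D, l1, l2, l3, S, lorentz_gram, cross, psub, padd, pscal, dot; simpl. ring. }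
  rewrite E. pose proof (Rle_0_sqr D) as H. unfold Rsqr in H. lra.
Qed.

(** * The cross-ratio distance and its hyperbolic functions *)

Lemma dist2_on_line P U s t :
  dist2 (padd P (pscal s U)) (padd P (pscal t U)) = Rabs (s - t) * sqrt (dot U U).
Proof.
  unfold dist2. replace (dot _ _) with ((s - t) * (s - t) * dot U U)
    by (unfold dot, psub, padd, pscal; simpl; ring).
  rewrite sqrt_mult;
    [|apply Rle_0_sqr|apply Rplus_le_le_0_compat; apply Rle_0_sqr].
  f_equal. change ((s - t) * (s - t)) with (Rsqr (s - t)). apply sqrt_Rsqr_abs.
Qed.

Lemma padd_pscal0 P U : padd P (pscal 0 U) = P.
Proof. destruct P. unfold padd, pscal; simpl. f_equal; ring. Qed.

Lemma padd_pscal1 P Q : padd P (pscal 1 (psub Q P)) = Q.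
Proof. destruct P, Q. unfold padd, pscal, psub; simpl. f_equal; ring. Qed.

Lemma cosh_half_ln_sq X : 0 < X ->
  cosh (/ 2 * ln X) * cosh (/ 2 * ln X) = (X + 1) * (X + 1) / (4 * X).
Proof.
  intros HX. unfold cosh. set (u := exp (/ 2 * ln X)).
  assert (Hu : 0 < u) by apply exp_pos.
  assert (Huu : u * u = X).
  { unfold u. rewrite <- exp_plus. replace (/ 2 * ln X + / 2 * ln X) with (ln X) by field.
    now apply exp_ln. }
  rewrite exp_Ropp. fold u. rewrite <- Huu. field. lra.
Qed.

Lemma cosh_dK_sq P Q : inD P -> inD Q -> P <> Q ->
  cosh (dK P Q) * cosh (dK P Q)
    = (1 - dot P Q) * (1 - dot P Q) / ((1 - dot P P) * (1 - dot Q Q)).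
Proof.
  intros HP HQ Hne. unfold dK, chord_v1, chord_v2.
  set (a := dot (psub Q P) (psub Q P)). set (b := dot P (psub Q P)).
  set (N := 1 - dot P P). set (M := 1 - dot Q Q).
  assert (HN : 0 < N) by (unfold N, inD in *; lra).
  assert (HM : 0 < M) by (unfold M, inD in *; lra).
  assert (HMe : M = N - 2 * b - a)
    by (unfold M, N, a, b, dot, psub; simpl; ring).
  assert (HPQ : 1 - dot P Q = N - b)
    by (unfold N, b, dot, psub; simpl; ring).
  assert (Ha : 0 < a) by now apply dot_psub_pos.
  set (q := sqrt (b * b + a * N)).
  assert (Hdisc : 0 < b * b + a * N)
    by (pose proof (Rle_0_sqr b) as S; pose proof (Rmult_lt_0_compat a N Ha HN);
        unfold Rsqr in S; lra).
  assert (Hq : 0 < q) by now apply sqrt_lt_R0.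
  assert (Hqq : q * q = b * b + a * N) by (apply sqrt_sqrt; lra).
  assert (E1 : chord_s P Q (-1) = (- b - q) / a).
  { unfold chord_s. fold a b q. replace (b * b - a * (dot P P - 1)) with (b * b + a * N)
      by (unfold N; ring). fold q. field. lra. }
  assert (E2 : chord_s P Q 1 = (- b + q) / a).
  { unfold chord_s. fold a b. replace (b * b - a * (dot P P - 1)) with (b * b + a * N)
      by (unfold N; ring). fold q. field. lra. }
  rewrite E1, E2. clear E1 E2.
  (* [H1] to [H4] say that the chord parameters satisfy s1 < 0, s2 > 0, s1 < 1 and s2 > 1: both
     points lie strictly between the chord ends. [Hq2] is the discriminant computed from [Q]. *)
  assert (H1 : 0 < b + q).
  { destruct (Rlt_le_dec 0 (b + q)); auto. exfalso. nra. }
  assert (H2 : 0 < q - b).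
  { destruct (Rlt_le_dec 0 (q - b)); auto. exfalso. nra. }
  assert (Hq2 : q * q = (a + b) * (a + b) + a * M) by (rewrite Hqq, HMe; ring).
  assert (H3 : 0 < a + b + q).
  { destruct (Rlt_le_dec 0 (a + b + q)); auto. exfalso. nra. }
  assert (H4 : 0 < q - b - a).
  { destruct (Rlt_le_dec 0 (q - b - a)); auto. exfalso. nra. }
  set (U := psub Q P). fold U in a.
  set (s1 := (- b - q) / a). set (s2 := (- b + q) / a).
  assert (Hs1 : s1 * a = - b - q) by (unfold s1; field; lra).
  assert (Hs2 : s2 * a = - b + q) by (unfold s2; field; lra).
  assert (D1 : dist2 (padd P (pscal s1 U)) P = (b + q) / a * sqrt a).
  { transitivity (dist2 (padd P (pscal s1 U)) (padd P (pscal 0 U))); [now rewrite padd_pscal0|].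
    rewrite dist2_on_line. f_equal. rewrite Rabs_left by (unfold Rminus; nra).
    unfold s1. field. lra. }
  assert (D2 : dist2 (padd P (pscal s2 U)) P = (q - b) / a * sqrt a).
  { transitivity (dist2 (padd P (pscal s2 U)) (padd P (pscal 0 U))); [now rewrite padd_pscal0|].
    rewrite dist2_on_line. f_equal. rewrite Rabs_pos_eq by nra.
    unfold s2. field. lra. }
  assert (D3 : dist2 (padd P (pscal s1 U)) Q = (a + b + q) / a * sqrt a).
  { transitivity (dist2 (padd P (pscal s1 U)) (padd P (pscal 1 U)));
      [unfold U; now rewrite padd_pscal1|].
    rewrite dist2_on_line. f_equal. rewrite Rabs_left by nra.
    unfold s1. field. lra. }
  assert (D4 : dist2 (padd P (pscal s2 U)) Q = (q - b - a) / a * sqrt a).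
  { transitivity (dist2 (padd P (pscal s2 U)) (padd P (pscal 1 U)));
      [unfold U; now rewrite padd_pscal1|].
    rewrite dist2_on_line. f_equal. rewrite Rabs_pos_eq by nra.
    unfold s2. field. lra. }
  rewrite D1, D2, D3, D4. assert (Hsa : 0 < sqrt a) by now apply sqrt_lt_R0.
  set (X := (a + b + q) * (q - b) / ((b + q) * (q - b - a))).
  replace (_ / _) with X by (unfold X; field; repeat split; lra).
  assert (HX : 0 < X).
  { unfold X. apply Rdiv_lt_0_compat; now apply Rmult_lt_0_compat. }
  assert (Heven : forall y, cosh (/ 2 * Rabs y) = cosh (/ 2 * y)).
  { intros y. unfold Rabs. destruct (Rcase_abs y); auto. unfold cosh.
    replace (- (/ 2 * - y)) with (/ 2 * y) by ring.
    replace (/ 2 * - y) with (- (/ 2 * y)) by ring. f_equal. apply Rplus_comm. }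
  rewrite Heven, cosh_half_ln_sq, HPQ by auto.
  (* With the cross-ratio written as n / d, the squared cosh is (n + d)^2 / (4 n d). Vieta's
     relations give n d and n + d without the root [q]. *)
  assert (K1 : (q - b) * (b + q) = a * N) by (replace (a * N) with (q * q - b * b) by lra; ring).
  assert (K2 : (a + b + q) * (q - b - a) = a * M)
    by (replace (a * M) with (q * q - (a + b) * (a + b)) by lra; ring).
  assert (K3 : (a + b + q) * (q - b) + (b + q) * (q - b - a) = 2 * a * (N - b)).
  { replace (2 * a * (N - b)) with (2 * (q * q) - 2 * b * b - 2 * a * b) by (rewrite Hqq; ring). ring. }
  set (n := (a + b + q) * (q - b)) in *. set (d := (b + q) * (q - b - a)) in *.
  assert (Hn : 0 < n) by now apply Rmult_lt_0_compat.
  assert (Hd : 0 < d) by now apply Rmult_lt_0_compat.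
  assert (K4 : n * d = (a * N) * (a * M)) by (rewrite <- K1, <- K2; unfold n, d; ring).
  transitivity ((n + d) * (n + d) / (4 * (n * d))).
  { unfold X. field. lra. }
  rewrite K3, K4. field. lra.
Qed.

Lemma sinh_sq x : sinh x * sinh x = cosh x * cosh x - 1.
Proof.
  unfold sinh, cosh. rewrite exp_Ropp. pose proof (exp_pos x). field. lra.
Qed.

Lemma sinh_dK_sq P Q : inD P -> inD Q -> P <> Q ->
  sinh (dK P Q) * sinh (dK P Q) = lorentz_gram P Q / ((1 - dot P P) * (1 - dot Q Q)).
Proof.
  intros HP HQ Hne. rewrite sinh_sq, cosh_dK_sq by auto. unfold lorentz_gram, inD in *.
  field. lra.
Qed.

Lemma dK_nonneg P Q : 0 <= dK P Q.
Proof. unfold dK. pose proof (Rabs_pos (ln (dist2 (chord_v1 P Q) Q * dist2 (chord_v2 P Q) P /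
       (dist2 (chord_v1 P Q) P * dist2 (chord_v2 P Q) Q)))). lra. Qed.

Lemma sinh_le x y : x <= y -> sinh x <= sinh y.
Proof. intros [H|H]; [left; now apply sinh_lt|subst; lra]. Qed.

Lemma dK_pos P Q : inD P -> inD Q -> P <> Q -> 0 < dK P Q.
Proof.
  intros HP HQ Hne. destruct (dK_nonneg P Q) as [H|H]; auto. exfalso.
  pose proof (sinh_dK_sq P Q HP HQ Hne) as E. rewrite <- H, sinh_0 in E.
  pose proof (lorentz_gram_pos P Q HP Hne). unfold inD in *.
  assert (0 < lorentz_gram P Q / ((1 - dot P P) * (1 - dot Q Q))).
  { apply Rdiv_lt_0_compat; auto. apply Rmult_lt_0_compat; lra. }
  lra.
Qed.

(** The second factor is sinh (2 d') expanded, so [DeltaK 2] is the length whose sinh is the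
    reciprocal of sinh (2 d'). *)
Lemma sinh_DeltaK2 P Q : 0 < dK P Q ->
  sinh (DeltaK 2 P Q) * (2 * sinh (dK P Q) * cosh (dK P Q)) = 1.
Proof.
  intros Hd. unfold DeltaK. set (d := dK P Q) in *. set (E := exp d).
  assert (HE : 1 < E) by (unfold E; rewrite <- exp_0; now apply exp_increasing).
  replace (exp (INR 2 * d)) with (E * E)
    by (unfold E; rewrite <- exp_plus; f_equal; simpl; ring).
  unfold sinh, cosh. rewrite !exp_Ropp. fold E.
  rewrite exp_ln by (apply Rdiv_lt_0_compat; nra).
  field. repeat split; nra.
Qed.

Lemma hypothesis_in_coordinates P Q Rp :
  inD P -> inD Q -> inD Rp -> cross (psub Q P) (psub Rp P) <> 0 ->
  Rbar_lt (deltaK P Q Rp) (Finite (DeltaK 2 P Q)) ->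
  4 * ((1 - dot P Q) * (1 - dot P Q))
    * (cross (psub Q P) (psub Rp P) * cross (psub Q P) (psub Rp P))
    < ((1 - dot P P) * (1 - dot Q Q)) * ((1 - dot P P) * (1 - dot Q Q)) * (1 - dot Rp Rp).
Proof.
  intros HP HQ HR Hcr Hlt.
  assert (HPQ : P <> Q).
  { intros ->. apply Hcr. unfold cross, psub; simpl; ring. }
  (* If no [S] on the chord were closer than [DeltaK 2 P Q], that number would be a lower bound,
     hence at most the infimum. *)
  destruct (Classical_Prop.classic
    (exists S, on_chord P Q S /\ dK Rp S < DeltaK 2 P Q)) as [(S & [HS [s Es]] & HdS)|Hno].
  2:{ exfalso. apply (Rbar_lt_not_le _ _ Hlt). unfold deltaK.
      apply Glb_Rbar_correct. intros y (S & HS & ->). simpl.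
      apply Rnot_lt_le. intros H. apply Hno. now exists S. }
  assert (HRS : Rp <> S).
  { intros ->. apply Hcr. rewrite Es. unfold cross, psub, padd, pscal; simpl; ring. }
  pose proof (dK_pos P Q HP HQ HPQ) as Hd.
  pose proof (sinh_DeltaK2 P Q Hd) as HD.
  pose proof (cosh_dK_sq P Q HP HQ HPQ) as Hc.
  pose proof (sinh_dK_sq P Q HP HQ HPQ) as Hs.
  pose proof (sinh_dK_sq Rp S HR HS HRS) as Hr.
  pose proof (sinh_lt _ _ HdS) as Hlt'.
  pose proof (sinh_le _ _ (dK_nonneg Rp S)) as Hr0. rewrite sinh_0 in Hr0.
  pose proof (lorentz_gram_line P Q Rp s) as HL. simpl in HL. rewrite <- Es in HL.
  pose proof (lorentz_gram_pos P Q HP HPQ) as HW.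
  unfold inD in HP, HQ, HR, HS.
  set (sh := sinh (dK P Q)) in *. set (ch := cosh (dK P Q)) in *.
  set (r := sinh (dK Rp S)) in *. set (D := sinh (DeltaK 2 P Q)) in *.
  set (W := lorentz_gram P Q) in *. set (V := lorentz_gram Rp S) in *.
  set (K := cross (psub Q P) (psub Rp P)) in *.
  set (n := 1 - dot P P) in *. set (m := 1 - dot Q Q) in *. set (k := 1 - dot Rp Rp) in *.
  set (l := 1 - dot S S) in *. set (g := 1 - dot P Q) in *.
  assert (Hn : 0 < n) by (unfold n; lra). assert (Hm : 0 < m) by (unfold m; lra).
  assert (Hk : 0 < k) by (unfold k; lra). assert (Hl : 0 < l) by (unfold l; lra).
  assert (Hnm : 0 < n * m) by now apply Rmult_lt_0_compat.
  assert (Hprod : (r * r) * (4 * (sh * sh) * (ch * ch)) < 1).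
  { assert (Hy : 0 < 2 * sh * ch).
    { apply (Rmult_lt_reg_l D); [lra|]. rewrite HD. lra. }
    assert (Hz : 0 <= r * (2 * sh * ch)) by (apply Rmult_le_pos; lra).
    assert (Hz1 : r * (2 * sh * ch) < 1) by (rewrite <- HD; now apply Rmult_lt_compat_r).
    replace (r * r * _) with ((r * (2 * sh * ch)) * (r * (2 * sh * ch))) by ring. nra. }
  rewrite Hr, Hs, Hc in Hprod.
  replace (V / (k * l) * (4 * (W / (n * m)) * (g * g / (n * m))))
    with ((4 * (g * g)) * (V * W) / ((n * m) * (n * m) * k * l)) in Hprod by (field; lra).
  (* The factor [l] of the auxiliary point [S] is what [lorentz_gram_line] absorbs, so [S]
     disappears from the result. *)
  apply (Rmult_lt_reg_r l); auto.
  apply Rle_lt_trans with (4 * (g * g) * (V * W)).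
  - replace (4 * (g * g) * (K * K) * l) with (4 * (g * g) * (K * K * l)) by ring.
    apply Rmult_le_compat_l; [nra|exact HL].
  - assert (Hden : 0 < n * m * (n * m) * k * l) by (repeat apply Rmult_lt_0_compat; auto).
    apply (Rmult_lt_compat_r _ _ _ Hden) in Hprod.
    replace (4 * (g * g) * (V * W) / (n * m * (n * m) * k * l) * (n * m * (n * m) * k * l))
      with (4 * (g * g) * (V * W)) in Hprod by (field; lra). lra.
Qed.

(** Since [(1 - dot P P) * (1 - dot Q Q)] is at most [(1 - dot P Q)] squared, one factor of it
    cancels from the inequality for [ababc]. *)
Lemma elliptic3_of_elliptic5 P Q Rp :
  inD P -> inD Q -> inD Rp ->
  4 * ((1 - dot P Q) * (1 - dot P Q))
    * (cross (psub Q P) (psub Rp P) * cross (psub Q P) (psub Rp P))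
    < ((1 - dot P P) * (1 - dot Q Q)) * ((1 - dot P P) * (1 - dot Q Q)) * (1 - dot Rp Rp) ->
  cross (psub Q P) (psub Rp P) * cross (psub Q P) (psub Rp P)
    < (1 - dot P P) * (1 - dot Q Q) * (1 - dot Rp Rp).
Proof.
  intros HP HQ HR H. unfold inD in HP, HQ, HR.
  assert (HG : (1 - dot P P) * (1 - dot Q Q) <= (1 - dot P Q) * (1 - dot P Q)).
  { destruct (Classical_Prop.classic (P = Q)) as [->|Hne]; [lra|].
    pose proof (lorentz_gram_pos P Q HP Hne) as HW. unfold lorentz_gram in HW. lra. }
  set (K := cross (psub Q P) (psub Rp P)) in *. set (g := (1 - dot P Q) * (1 - dot P Q)) in *.
  assert (HN : 0 < (1 - dot P P) * (1 - dot Q Q)) by (apply Rmult_lt_0_compat; lra).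
  set (N := (1 - dot P P) * (1 - dot Q Q)) in *. set (k := 1 - dot Rp Rp) in *.
  pose proof (Rle_0_sqr K) as HK. unfold Rsqr in HK. set (K2 := K * K) in *.
  apply (Rmult_lt_reg_l N); auto. nra.
Qed.

(** * The lift of the tangent map *)

Section Triangle.

Variables P1 P2 P3 : pt.
Hypotheses (D1 : inD P1) (D2 : inD P2) (D3 : inD P3).

Definition vert (a : vertex) : pt := match a with V1 => P1 | V2 => P2 | V3 => P3 end.

Definition cot_max (t : R) : R :=
  Rmax (Rmax (cot_angle P1 t) (cot_angle P2 t)) (cot_angle P3 t).

(** The arccotangent decreases, so the largest cotangent gives the least of the three turns. *)
Definition psi_lift (t : R) : R := t + arccot_turn (cot_max t).

Lemma inD_vert a : inD (vert a).
Proof. destruct a; auto. Qed.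

Lemma cot_max_ge a t : cot_angle (vert a) t <= cot_max t.
Proof.
  unfold cot_max, Rmax. destruct a; simpl; repeat destruct Rle_dec; lra.
Qed.

Lemma cot_max_attained t : exists a, cot_max t = cot_angle (vert a) t.
Proof.
  unfold cot_max, Rmax.
  repeat destruct Rle_dec; first [now exists V1|now exists V2|now exists V3].
Qed.

Lemma psi_lift_le a t : psi_lift t <= turn (vert a) t.
Proof. unfold psi_lift, turn. apply Rplus_le_compat_l, arccot_turn_decr, cot_max_ge. Qed.

Lemma psi_lift_attained t : exists a, psi_lift t = turn (vert a) t.
Proof.
  destruct (cot_max_attained t) as [a E]. exists a. unfold psi_lift, turn. now rewrite E.
Qed.

Lemma psi_lift_incr x y : x <= y -> psi_lift x <= psi_lift y.
Proof.
  intros H. destruct (psi_lift_attained y) as [a ->].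
  apply Rle_trans with (1 := psi_lift_le a x).
  destruct H as [H|H]; [left|subst; lra]. now apply (involutive_lift_turn _ (inD_vert a)).
Qed.

Lemma psi_lift_shift x : psi_lift (x + 1) = psi_lift x + 1.
Proof.
  assert (S : forall a x, turn (vert a) (x + 1) = turn (vert a) x + 1).
  { intros a y. apply involutive_lift_shift, involutive_lift_turn, inD_vert. }
  destruct (psi_lift_attained (x + 1)) as [a Ea]. destruct (psi_lift_attained x) as [b Eb].
  pose proof (psi_lift_le b (x + 1)). pose proof (psi_lift_le a x). rewrite S in *. lra.
Qed.

Lemma Rmax_continuity f g : continuity f -> continuity g -> continuity (fun x => Rmax (f x) (g x)).
Proof.
  intros Hf Hg x.
  apply (continuity_pt_ext (fun x => ((f x + g x) + Rabs (f x - g x)) * / 2)).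
  - intros y. unfold Rmax, Rabs. destruct Rle_dec, Rcase_abs; lra.
  - apply continuity_pt_mult; [|apply continuity_pt_const; now intros ? ?].
    apply continuity_pt_plus; [now apply continuity_pt_plus|].
    apply (continuity_pt_comp (fun x => f x - g x) Rabs); [now apply continuity_pt_minus|].
    apply Rcontinuity_abs.
Qed.

Lemma psi_lift_continuity : continuity psi_lift.
Proof.
  unfold psi_lift. apply continuity_plus.
  - apply derivable_continuous, derivable_id.
  - apply (continuity_comp cot_max arccot_turn); [|apply arccot_turn_continuity].
    repeat apply Rmax_continuity; now apply cot_angle_continuity.
Qed.

(** Comparing cotangents decides on which side of a chord from [e t] a point lies. *)
Lemma cross_chord m P t : inD P ->
  exists k, 0 < k /\ cross (psub (e (t + arccot_turn m)) (e t)) (psub P (e t))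
    = k * (m - cot_angle P t).
Proof.
  intros HP. pose proof (dot_lt_1 P (e t) HP ltac:(rewrite norm_e; lra)) as HA.
  pose proof (sin_turn_pos _ (arccot_turn_bounds m)) as Hq.
  set (q := sin (PI * arccot_turn m)) in *.
  assert (Hpq : cos (PI * arccot_turn m) = m * q).
  { unfold q. rewrite cos_arccot_turn, sin_arccot_turn. reflexivity. }
  assert (Hn : (m * q) * (m * q) + q * q = 1).
  { rewrite <- Hpq. unfold q. pose proof (sin2_cos2 (PI * arccot_turn m)) as S.
    unfold Rsqr in S. lra. }
  (* Rotation by the central angle, twice the angle with sine [q] and cosine [m * q]. *)
  assert (Ew : e (t + arccot_turn m) =
    (fst (e t) * (1 - 2 * q * q) - snd (e t) * (2 * (q * (m * q))),
     snd (e t) * (1 - 2 * q * q) + fst (e t) * (2 * (q * (m * q))))).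
  { unfold e. cbn [fst snd].
    replace (2 * PI * (t + arccot_turn m)) with (2 * PI * t + 2 * (PI * arccot_turn m)) by ring.
    rewrite cos_plus, sin_plus, sin_2a, cos_2a_sin, Hpq. fold q. f_equal; ring. }
  exists (2 * q * q * (1 - dot P (e t))). split.
  { repeat apply Rmult_lt_0_compat; lra. }
  unfold cot_angle.
  replace (2 * q * q * (1 - dot P (e t)) * (m - cross (e t) P / (1 - dot P (e t))))
    with (2 * q * q * (m * (1 - dot P (e t)) - cross (e t) P)) by (field; lra).
  rewrite Ew. pose proof (norm_e t) as Hv. destruct (e t) as [c s], P as [x y].
  unfold dot, cross, psub in *; simpl in *.
  replace (m * (1 - (x * c + y * s))) with (m * ((c * c + s * s) - (x * c + y * s)))
    by (rewrite Hv; ring). ring.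
Qed.

Lemma e_neq t u : 0 < u < 1 -> e (t + u) <> e t.
Proof.
  intros Hu E. unfold e in E. injection E as Ec Es.
  replace (2 * PI * (t + u)) with (2 * PI * t + 2 * (PI * u)) in * by ring.
  set (x := 2 * PI * t) in *.
  assert (C : cos (2 * (PI * u)) = 1).
  { replace (2 * (PI * u)) with ((x + 2 * (PI * u)) - x) by ring.
    rewrite cos_minus, Ec, Es. pose proof (sin2_cos2 x) as S. unfold Rsqr in S. lra. }
  rewrite cos_2a_sin in C. pose proof (sin_turn_pos u Hu). nra.
Qed.

Lemma vert_in_triangle a : filled_triangle P1 P2 P3 (vert a).
Proof.
  destruct a; [exists 1, 0, 0|exists 0, 1, 0|exists 0, 0, 1];
    repeat split; try lra; apply injective_projections; simpl; ring.
Qed.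

(** The vertex of largest cotangent lies on the chord and the others weakly to its left; being
    affine, the condition passes to convex combinations. *)
Lemma psi_lift_is_psi t : is_psi (filled_triangle P1 P2 P3) (e t) (e (psi_lift t)).
Proof.
  unfold psi_lift. split; [|split].
  - apply e_neq, arccot_turn_bounds.
  - destruct (cot_max_attained t) as [a E]. exists (vert a). split; [apply vert_in_triangle|].
    destruct (cross_chord (cot_max t) (vert a) t (inD_vert a)) as [k [_ ->]]. rewrite E. ring.
  - intros p (a & b & c & Ha & Hb & Hc & Hs & ->).
    assert (H : forall i, 0 <= cross (psub (e (t + arccot_turn (cot_max t))) (e t))
                                     (psub (vert i) (e t))).
    { intros i. destruct (cross_chord (cot_max t) (vert i) t (inD_vert i)) as [k [Hk ->]].
      pose proof (cot_max_ge i t). apply Rmult_le_pos; lra. }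
    pose proof (H V1) as K1. pose proof (H V2) as K2. pose proof (H V3) as K3. simpl in K1, K2, K3.
    set (u := psub (e (t + _)) (e t)) in *.
    replace (cross u (psub (padd (pscal a P1) (padd (pscal b P2) (pscal c P3))) (e t)))
      with (a * cross u (psub P1 (e t)) + b * cross u (psub P2 (e t)) + c * cross u (psub P3 (e t))).
    2:{ replace c with (1 - a - b) by lra. unfold cross, psub, padd, pscal; simpl. ring. }
    pose proof (Rmult_le_pos _ _ Ha K1). pose proof (Rmult_le_pos _ _ Hb K2).
    pose proof (Rmult_le_pos _ _ Hc K3). lra.
Qed.

Lemma psi_lift_normalized : is_normalized_lift_psi (filled_triangle P1 P2 P3) psi_lift.
Proof.
  split; [apply psi_lift_continuity|split; [apply psi_lift_is_psi|]].
  unfold psi_lift. pose proof (arccot_turn_bounds (cot_max 0)). lra.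
Qed.

(** At each point the lift agrees with one of the turns, so letters chosen along the orbit spell the
    fifth iterate. *)
Lemma psi_lift_iter5 : (forall a b c d f x, x + 2 <
    turn (vert a) (turn (vert b) (turn (vert c) (turn (vert d) (turn (vert f) x))))) ->
  forall x, x + 2 < Nat.iter 5 psi_lift x.
Proof.
  intros H x. simpl.
  destruct (psi_lift_attained x) as [f ->].
  destruct (psi_lift_attained (turn (vert f) x)) as [d ->].
  destruct (psi_lift_attained (turn (vert d) (turn (vert f) x))) as [c ->].
  destruct (psi_lift_attained (turn (vert c) (turn (vert d) (turn (vert f) x)))) as [b ->].
  destruct (psi_lift_attained (turn (vert b) (turn (vert c) (turn (vert d) (turn (vert f) x)))))
    as [a ->].
  apply H.
Qed.

End Triangle.

Theorem theorem5p3 (P1 P2 P3 : pt) :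
  inD P1 -> inD P2 -> inD P3 ->
  ~ collinear P1 P2 P3 ->
  (forall Pi Pj Pk : pt,
     (Pi, Pj, Pk) = (P1, P2, P3) \/ (Pi, Pj, Pk) = (P1, P3, P2) \/
     (Pi, Pj, Pk) = (P2, P1, P3) \/ (Pi, Pj, Pk) = (P2, P3, P1) \/
     (Pi, Pj, Pk) = (P3, P1, P2) \/ (Pi, Pj, Pk) = (P3, P2, P1) ->
     Rbar_lt (deltaK Pi Pj Pk) (Finite (DeltaK 2 Pi Pj))) ->
  exists F : R -> R,
    is_normalized_lift_psi (filled_triangle P1 P2 P3) F /\
    exists rho : R, rho > 2 / 5 /\
      forall x : R, is_lim_seq (fun n : nat => (Nat.iter n F x - x) / INR n) rho.
Proof.
  intros D1 D2 D3 Hcol Hyp.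
  pose proof (inD_vert P1 P2 P3 D1 D2 D3) as Dv. set (v := vert P1 P2 P3) in *.
  assert (Hell : forall a b c, a <> b -> b <> c -> a <> c ->
    4 * ((1 - dot (v a) (v b)) * (1 - dot (v a) (v b)))
      * (cross (psub (v b) (v a)) (psub (v c) (v a)) * cross (psub (v b) (v a)) (psub (v c) (v a)))
    < ((1 - dot (v a) (v a)) * (1 - dot (v b) (v b)))
      * ((1 - dot (v a) (v a)) * (1 - dot (v b) (v b))) * (1 - dot (v c) (v c))).
  { intros a b c Hab Hbc Hac. apply hypothesis_in_coordinates; auto.
    (* Permuting the vertices changes the cross product at most by a sign. *)
    - intros E. apply Hcol. unfold collinear. unfold cross, psub, v in *.
      destruct a, b, c; try congruence; simpl in *; lra.
    - apply Hyp. destruct a, b, c; try congruence; simpl; tauto. }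
  assert (Lf : forall a, involutive_lift (turn (v a))) by (intros; now apply involutive_lift_turn).
  exists (psi_lift P1 P2 P3). split; [now apply psi_lift_normalized|].
  destruct (rotation_number_exists (psi_lift P1 P2 P3)) as [rho Hrho].
  { now apply psi_lift_incr. }
  { now apply psi_lift_shift. }
  exists rho. split; auto.
  assert (Hadv : forall x, x + INR 2 < Nat.iter 5 (psi_lift P1 P2 P3) x).
  { replace (INR 2) with 2 by (simpl; ring). apply psi_lift_iter5.
    apply (all_words5 (fun a => turn (v a))); auto.
    - intros a b c Hab Hbc Hac. apply word3_gt; auto. intros x. apply turn3_neq; auto.
      apply elliptic3_of_elliptic5; auto.
    - intros a b c Hab Hbc Hac. apply word5_gt; auto. intros x. apply turn5_neq; auto. }
  replace (2 / 5) with (INR 2 / INR 5) by (simpl; field).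
  apply (rotation_number_gt (psi_lift P1 P2 P3)) with (x := 0); auto; try lia.
  - now apply psi_lift_continuity.
  - now apply psi_lift_shift.
Qed.
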